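(* Let $n$ be a positive integer. For any positive integer $k$, the $k$th power of the circulant determinant of order $n$ satisfies $$\mathrm{C}(x_1, x_2, \ldots, x_n)^k = \sum_{\lambda \in \Lambda_n^k} m_\lambda(\zeta_{(n,k)})\, x_\lambda = \sum_{\lambda \in \tilde{\Lambda}_n^k} m_\lambda(\zeta_{(n,k)})\, x_\lambda,$$ where $x_\lambda := x_{\lambda_1} x_{\lambda_2} \cdots x_{\lambda_{kn}}$.
   Context: The circulant determinant of order $n$ in the indeterminates $x_1, \ldots, x_n$ is $$\mathrm{C}(x_1, x_2, \ldots, x_n) := \det\begin{pmatrix} x_n & x_{n-1} & \cdots & x_1 \\ x_1 & x_n & \cdots & x_2 \\ \vdots & \vdots & \ddots & \vdots \\ x_{n-1} & x_{n-2} & \cdots & x_n \end{pmatrix},$$ i.e. the $(i,j)$ entry is $x_r$ with $r \in \{1,\ldots,n\}$, $r \equiv i-j \pmod n$. For a positive integer $N$, the symmetric group $\mathfrak{S}_N$ acts on $\mathbb{Z}^N$ by $\sigma\cdot\lambda := (\lambda_{\sigma^{-1}(1)}, \ldots, \lambda_{\sigma^{-1}(N)})$. For $\lambda \in \mathbb{Z}^N$, the monomial symmetric (Laurent) polynomial in variables $y = (y_1,\ldots,y_N)$ is $$m_\lambda(y) := \sum_{\mu \in \mathfrak{S}_N\cdot\lambda} y^\mu, \qquad y^\mu := y_1^{\mu_1}\cdots y_N^{\mu_N},$$ where the sum is over the orbit $\mathfrak{S}_N\cdot\lambda = \{\sigma\cdot\lambda \mid \sigma \in \mathfrak{S}_N\}$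 as a set (each distinct rearrangement of $\lambda$ counted once). Let $\zeta_n$ be a primitive complex $n$th root of unity and $\zeta_{(n,k)} := (1, \zeta_n, \zeta_n^2, \ldots, \zeta_n^{kn-1}) \in \mathbb{C}^{kn}$; $m_\lambda(\zeta_{(n,k)})$ is the value of $m_\lambda$ (with $N = kn$) at this point. $$\Lambda_n^k := \{(\lambda_1, \ldots, \lambda_{kn}) \in \mathbb{Z}^{kn} \mid 1 \leq \lambda_1 \leq \lambda_2 \leq \cdots \leq \lambda_{kn} \leq n\},\qquad \tilde{\Lambda}_n^k := \{\lambda \in \Lambda_n^k \mid |\lambda| \equiv 0 \pmod n\},$$ where $|\lambda| := \lambda_1 + \lambda_2 + \cdots + \lambda_{kn}$. *)

(* Defs.v *)
From HB Require Import structures.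
From mathcomp Require Import all_boot all_order all_algebra all_fingroup.
From mathcomp Require Import finmap mpoly complex reals.

Set Implicit Arguments.
Unset Strict Implicit.
Unset Printing Implicit Defensive.

Import Order.TTheory GRing.Theory Num.Theory.
Local Open Scope ring_scope.

(* Indices are shifted by one throughout: i : 'I_N stands for the position
   i + 1, and r : 'I_n for the label r + 1 in {1, ..., n}.  In particular,
   'X_r : {mpoly F[n]} is the indeterminate x_(r+1). *)

Lemma circ_idx_subproof (n : nat) (i j : 'I_n) : ((i + n - j.+1) %% n < n)%N.
Proof. by rewrite ltn_pmod // (leq_ltn_trans (leq0n i)). Qed.

(* The label r + 1 is congruent to i - j modulo n, hence r to i - j - 1; the
   summand n keeps the natural-number subtraction from being truncated. *)
Definition circ_idx (n : nat) (i j : 'I_n) : 'I_n :=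
  Ordinal (circ_idx_subproof i j).

Definition circulant_mx (A : comNzRingType) (n : nat) (x : 'I_n -> A) : 'M[A]_n :=
  \matrix_(i < n, j < n) x (circ_idx i j).

Definition circulant_det (A : comNzRingType) (n : nat) (x : 'I_n -> A) : A :=
  \det (circulant_mx x).

Definition perm_act (N : nat) (s : 'S_N) (lam : {ffun 'I_N -> int}) :
    {ffun 'I_N -> int} :=
  [ffun i => lam ((s^-1)%g i)].

Definition perm_orbit (N : nat) (lam : {ffun 'I_N -> int}) :
    {fset {ffun 'I_N -> int}} :=
  [fset perm_act s lam | s in [set: 'S_N]]%fset.

Definition laurent_monomial (F : fieldType) (N : nat) (mu : {ffun 'I_N -> int})
    (y : 'I_N -> F) : F :=
  \prod_(i < N) y i ^ mu i.

(* The value of m_lam at y; the sum is over a finite set, so that each distinct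
   rearrangement of lam is counted once. *)
Definition monomial_sym (F : fieldType) (N : nat) (lam : {ffun 'I_N -> int})
    (y : 'I_N -> F) : F :=
  \sum_(mu <- perm_orbit lam) laurent_monomial mu y.

Definition zeta_point (F : fieldType) (n k : nat) (z : F) : 'I_(k * n) -> F :=
  fun i => z ^+ i.
Arguments zeta_point {F} n k z i.

(* The integer vector with entries in {1, ..., n} encoded by l. *)
Definition parts (n N : nat) (l : {ffun 'I_N -> 'I_n}) : {ffun 'I_N -> int} :=
  [ffun i => ((l i).+1)%:Z].

Definition weight (N : nat) (lam : {ffun 'I_N -> int}) : int :=
  \sum_(i < N) lam i.

Definition Lambda (n k : nat) : {set {ffun 'I_(k * n) -> 'I_n}} :=
  [set l : {ffun 'I_(k * n) -> 'I_n} |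
    [forall i : 'I_(k * n), forall j : 'I_(k * n),
       (i <= j)%N ==> (parts l i <= parts l j)]].

Definition Lambda_tilde (n k : nat) : {set {ffun 'I_(k * n) -> 'I_n}} :=
  [set l in Lambda n k | (weight (parts l) == 0 %[mod n%:Z])%Z].

Definition x_monomial (A : comNzRingType) (n N : nat) (x : 'I_n -> A)
    (l : {ffun 'I_N -> 'I_n}) : A :=
  \prod_(i < N) x (l i).

(* Main.v *)
Require Import Defs.
From HB Require Import structures.
From mathcomp Require Import all_boot all_order all_algebra all_fingroup.
From mathcomp Require Import finmap mpoly complex reals.

Set Implicit Arguments.
Unset Strict Implicit.
Unset Printing Implicit Defensive.

Import Order.TTheory GRing.Theory Num.Theory.
Local Open Scope ring_scope.

(** The circulant matrix [A] is diagonalised by the characters of Z/n: the row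
   vector (1, z^m, z^2m, ...) is a left eigenvector of [A] with eigenvalue
   [\sum_r z^(m r) x_r], where r runs over the labels 1, ..., n.  The matrix of
   these n eigenvectors is the Vandermonde matrix of the powers of [z], whose
   determinant is nonzero in an integral domain, so [\det A] is the product of
   the n eigenvalues ([circulant_det_prod]).

   The eigenvalue depends on m only modulo n, hence the k-th power of the
   determinant is the product of the same linear forms over all m < kn, that
   is, over the coordinates of the point (1, z, ..., z^(kn-1)).  Expanding this
   product gives one term [y^f x_f] for each map f from the kn positions to the
   n labels.  As [x_f] is unchanged when f is rearranged, the terms are grouped
   by the sorted rearrangement l of f, which runs over [Lambda]; the f with
   sorted rearrangement l form the orbit of l, so the coefficient of [x_l] is
   the monomial symmetric polynomial at that point ([prod_linear_forms]).

   For the second equality, multiplying the point by [z] only shifts its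
   coordinates cyclically because [z^(kn) = 1].  A symmetric polynomial does
   not see the shift, whereas a homogeneous one of degree |l| is multiplied by
   [z^|l|]; its value is therefore zero unless n divides |l|
   ([monomial_sym_zeta0]). *)

(** * The determinant as a product of eigenvalues *)

Lemma circ_idxE (n : nat) (i j : 'I_n) :
  (j + (circ_idx i j).+1 = i %[mod n])%N.
Proof.
rewrite -addSnnS /= modnDmr subnKC ?modnDr //.
by rewrite (leq_trans (ltn_ord j)) ?leq_addl.
Qed.

Lemma circ_idx_inj (n : nat) (j : 'I_n) : injective (fun i => circ_idx i j).
Proof.
move=> i1 i2 eq_idx; apply/val_inj => /=.
by rewrite -(modn_small (ltn_ord i1)) -(modn_small (ltn_ord i2))
           -(circ_idxE i1 j) -(circ_idxE i2 j) eq_idx.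
Qed.

(** The differences of distinct powers z^i, z^j with i, j < n are nonzero. *)
Lemma det_Vandermonde_prim_root_neq0 (A : idomainType) (n : nat) (z : A) :
  n.-primitive_root z -> \det (Vandermonde n (\row_(j < n) z ^+ j)) != 0.
Proof.
move=> z_prim; rewrite det_Vandermonde.
apply/prodf_neq0 => i _; apply/prodf_neq0 => j lt_ij.
rewrite !mxE subr_eq0 (eq_prim_root_expr z_prim) !modn_small //.
by rewrite gtn_eqF.
Qed.

(** The eigenvectors are rows, not columns: summing down a column of the matrix
   makes z^i = z^j z^(i-j) appear with i - j positive as in the labels, which
   yields the eigenvalues without inverting z. *)
Lemma circulant_det_prod (A : idomainType) (n : nat) (z : A) (x : 'I_n -> A) :
    n.-primitive_root z ->
  circulant_det x = \prod_(m < n) \sum_(r < n) z ^+ (m * r.+1) * x r.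
Proof.
move=> z_prim; set V := Vandermonde n (\row_(j < n) z ^+ j).
pose d := \row_(m < n) \sum_(r < n) z ^+ (m * r.+1) * x r.
have eigenV : V *m circulant_mx x = diag_mx d *m V.
  apply/matrixP=> m j; rewrite mul_diag_mx !mxE mulr_suml.
  (* In column j, the label r = i - j is substituted for the row i. *)
  rewrite [RHS](reindex_inj (@circ_idx_inj n j)); apply: eq_bigr => i _.
  rewrite !mxE mulrAC; congr (_ * _); rewrite -!exprM mulnC -exprD.
  apply/eqP; rewrite (eq_prim_root_expr z_prim) [(j * m)%N]mulnC -mulnDr.
  by rewrite addnC -modnMmr -(circ_idxE i j) modnMmr.
have: \det V * circulant_det x = \det V * \prod_m d 0 m.
  by rewrite -det_diag [RHS]mulrC -!det_mulmx eigenV.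
move/(mulfI (det_Vandermonde_prim_root_neq0 z_prim)) => ->.
by apply: eq_bigr => m _; rewrite mxE.
Qed.

Lemma prod_periodic (A : comNzRingType) (n k : nat) (G : nat -> A) :
    (forall i, G (n + i)%N = G i) ->
  \prod_(i < k * n) G i = (\prod_(i < n) G i) ^+ k.
Proof.
move=> G_per; elim: k => [|k IHk]; first by rewrite big_ord0.
rewrite exprS -IHk -[(k.+1 * n)%N]/(n + k * n)%N big_split_ord; congr (_ * _).
by apply: eq_bigr => i _; apply: G_per.
Qed.

(** * Rearrangements of labellings *)

Definition values (n N : nat) (f : {ffun 'I_N -> 'I_n}) : N.-tuple 'I_n :=
  [tuple f i | i < N].

Definition label_le (n : nat) : rel 'I_n := fun a b => (a <= b)%N.

Definition sorted_rearr (n N : nat) (f : {ffun 'I_N -> 'I_n}) :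
    {ffun 'I_N -> 'I_n} :=
  [ffun i => tnth (sort_tuple (@label_le n) (values f)) i].

Lemma label_le_trans (n : nat) : transitive (@label_le n).
Proof. by move=> b a c; apply: leq_trans. Qed.

Lemma label_le_anti (n : nat) : antisymmetric (@label_le n).
Proof. by move=> a b /anti_leq /val_inj. Qed.

Lemma label_le_total (n : nat) : total (@label_le n).
Proof. by move=> a b; apply: leq_total. Qed.

Lemma values_inj (n N : nat) : injective (@values n N).
Proof.
move=> f g eq_fg; apply/ffunP => i.
by have := congr1 (fun t => tnth t i) eq_fg; rewrite !tnth_mktuple.
Qed.

Lemma values_sorted_rearr (n N : nat) (f : {ffun 'I_N -> 'I_n}) :
  values (sorted_rearr f) = sort_tuple (@label_le n) (values f).
Proof. by apply: eq_from_tnth => i; rewrite tnth_mktuple ffunE. Qed.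

Lemma in_LambdaE (n k : nat) (l : {ffun 'I_(k * n) -> 'I_n}) :
  (l \in Lambda n k) = sorted (@label_le n) (values l).
Proof.
rewrite inE; apply/idP/idP => [/forallP mono_l | sorted_l].
  (* The empty tuple is sorted; otherwise an element serves as the default. *)
  case: (posnP (k * n)) => [N0 | N_gt0].
    by have /size0nil -> : size (values l) = 0%N by rewrite size_tuple.
  apply/(sortedP (l (Ordinal N_gt0))) => i; rewrite size_tuple => lt_i.
  have /forallP/(_ (Ordinal lt_i)) := mono_l (Ordinal (ltnW lt_i)).
  rewrite leqnSn !ffunE lez_nat ltnS.
  by rewrite -(tnth_nth _ _ (Ordinal (ltnW lt_i)))
             -(tnth_nth _ _ (Ordinal lt_i)) !tnth_mktuple.
apply/forallP => i; apply/forallP => j; apply/implyP => le_ij.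
rewrite !ffunE lez_nat ltnS.
have := sorted_leq_nth (@label_le_trans n) (fun=> leqnn _) (l i) sorted_l.
move/(_ i j); rewrite !inE size_tuple !ltn_ord => /(_ isT isT le_ij).
by rewrite -!tnth_nth !tnth_mktuple.
Qed.

Lemma sorted_rearr_Lambda (n k : nat) (f : {ffun 'I_(k * n) -> 'I_n}) :
  sorted_rearr f \in Lambda n k.
Proof.
by rewrite in_LambdaE values_sorted_rearr; apply: (sort_sorted (@label_le_total n)).
Qed.

Lemma sorted_rearr_eq (n k : nat) (f l : {ffun 'I_(k * n) -> 'I_n}) :
  l \in Lambda n k -> (sorted_rearr f == l) = perm_eq (values f) (values l).
Proof.
rewrite in_LambdaE => sorted_l; apply/eqP/idP => [<- | perm_fl].
  by rewrite values_sorted_rearr perm_sym perm_sort.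
apply/values_inj/val_inj; rewrite values_sorted_rearr.
apply: (sorted_eq (@label_le_trans n) (@label_le_anti n)) => //.
  exact: (sort_sorted (@label_le_total n)).
by rewrite perm_sort.
Qed.

Lemma x_monomial_perm (A : comNzRingType) (n N : nat) (x : 'I_n -> A)
    (f g : {ffun 'I_N -> 'I_n}) :
  perm_eq (values f) (values g) -> x_monomial x f = x_monomial x g.
Proof.
have E (h : {ffun 'I_N -> 'I_n}) : x_monomial x h = \prod_(a <- values h) x a.
  by rewrite big_tuple; apply: eq_bigr => i _; rewrite tnth_mktuple.
by rewrite !E; apply: perm_big.
Qed.

(** * Monomial symmetric polynomials *)

Lemma perm_actM (N : nat) (s t : 'S_N) (lam : {ffun 'I_N -> int}) :
  perm_act s (perm_act t lam) = perm_act (t * s)%g lam.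
Proof. by apply/ffunP => i; rewrite !ffunE invMg permM. Qed.

Lemma perm_orbitP (N : nat) (lam mu : {ffun 'I_N -> int}) :
  reflect (exists s, mu = perm_act s lam) (mu \in perm_orbit lam).
Proof.
apply: (iffP (imfsetP _ _ _ _)) => [[s _ ->] | [s ->]]; first by exists s.
by exists s; rewrite ?inE.
Qed.

Lemma parts_inj (n N : nat) : injective (@parts n N).
Proof.
move=> f g /ffunP eq_fg; apply/ffunP => i.
by move: (eq_fg i); rewrite !ffunE => -[] /val_inj.
Qed.

(** The orbit of [parts l] consists of the vectors [parts f], f running over
   the rearrangements of l. *)
Lemma monomial_sym_parts (F : fieldType) (n N : nat)
    (l : {ffun 'I_N -> 'I_n}) (y : 'I_N -> F) :
  monomial_sym (parts l) y =
    \sum_(f : {ffun 'I_N -> 'I_n} | perm_eq (values f) (values l))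
      \prod_(i < N) y i ^+ (f i).+1.
Proof.
rewrite -big_filter; set r := filter _ _.
rewrite /monomial_sym (perm_big [seq parts f | f <- r]) /=; last first.
  apply: uniq_perm; first exact: fset_uniq.
    by rewrite (map_inj_uniq (@parts_inj n N)) filter_uniq // index_enum_uniq.
  move=> mu; apply/perm_orbitP/mapP => [[s ->] | [f + ->]].
    exists [ffun i => l ((s^-1)%g i)]; last by apply/ffunP => i; rewrite !ffunE.
    rewrite mem_filter mem_index_enum andbT; apply/tuple_permP; exists (s^-1)%g.
    by congr tval; apply: eq_from_tnth => i; rewrite !tnth_mktuple ffunE.
  rewrite mem_filter => /andP[/tuple_permP[s fE] _]; exists (s^-1)%g.
  apply/ffunP => i; rewrite !ffunE invgK; congr (Posz _.+1).
  have /(congr1 (fun t => tnth t i)) : values f = [tuple tnth (values l) (s j) | j < N].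
    exact: val_inj.
  by rewrite !tnth_mktuple => ->.
rewrite big_map; apply: eq_bigr => f _; apply: eq_bigr => i _.
by rewrite ffunE.
Qed.

Lemma laurent_monomial_perm (F : fieldType) (N : nat) (s : 'S_N)
    (mu : {ffun 'I_N -> int}) (y : 'I_N -> F) :
  laurent_monomial mu (fun i => y (s i)) = laurent_monomial (perm_act s mu) y.
Proof.
rewrite /laurent_monomial [RHS](reindex_inj (@perm_inj _ s)).
by apply: eq_bigr => i _; rewrite ffunE permK.
Qed.

Lemma monomial_sym_perm (F : fieldType) (N : nat) (s : 'S_N)
    (lam : {ffun 'I_N -> int}) (y : 'I_N -> F) :
  monomial_sym lam (fun i => y (s i)) = monomial_sym lam y.
Proof.
rewrite /monomial_sym [RHS](perm_big [seq perm_act s mu | mu <- perm_orbit lam]).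
  by rewrite big_map; apply: eq_bigr => mu _; apply: laurent_monomial_perm.
have act_inj : injective (perm_act s).
  move=> mu nu /(congr1 (perm_act s^-1)).
  rewrite !perm_actM mulgV.
  by move=> /ffunP E; apply/ffunP => i; move: (E i); rewrite !ffunE invg1 perm1.
apply: uniq_perm; rewrite ?map_inj_uniq ?fset_uniq // => mu.
apply/perm_orbitP/mapP => [[t ->] | [nu /perm_orbitP[t ->] ->]]; last first.
  by exists (t * s)%g; rewrite perm_actM.
exists (perm_act (t * s^-1) lam); last by rewrite perm_actM mulgKV.
by apply/perm_orbitP; exists (t * s^-1)%g.
Qed.

Lemma weight_perm_act (N : nat) (s : 'S_N) (lam : {ffun 'I_N -> int}) :
  weight (perm_act s lam) = weight lam.
Proof.
rewrite /weight (reindex_inj (@perm_inj _ s)).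
by apply: eq_bigr => i _; rewrite ffunE permK.
Qed.

Lemma monomial_sym_homog (F : fieldType) (N : nat) (c : F)
    (lam : {ffun 'I_N -> int}) (y : 'I_N -> F) : c != 0 ->
  monomial_sym lam (fun i => c * y i) = c ^ weight lam * monomial_sym lam y.
Proof.
move=> c_neq0; rewrite /monomial_sym mulr_sumr.
(* Membership in the orbit is kept, because it fixes the weight of mu. *)
rewrite big_seq [RHS]big_seq; apply: eq_bigr => mu /perm_orbitP[s muE].
rewrite -(weight_perm_act s lam) -muE /laurent_monomial.
under eq_bigr do rewrite expfzMl.
rewrite big_split; congr (_ * _).
by rewrite (big_morph (exprz c) (fun a b => expfzDr a b c_neq0) (expr0z c)).
Qed.

(** * The value at the powers of a root of unity *)

(** Both evaluations of M at z times the point, by symmetry and by homogeneity,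
   give M = z^|l| M, and z^|l| = 1 only when n divides |l|. *)
Lemma monomial_sym_zeta0 (F : fieldType) (n k : nat) (z : F)
    (l : {ffun 'I_(k * n) -> 'I_n}) :
    n.-primitive_root z -> (weight (parts l) != 0 %[mod n%:Z])%Z ->
  monomial_sym (parts l) (zeta_point n k z) = 0.
Proof.
move=> z_prim nz_wt; set M := monomial_sym _ _.
have z_neq0 : z != 0.
  apply: contra_eq_neq (prim_expr_order z_prim) => ->.
  by rewrite expr0n gtn_eqF ?(prim_order_gt0 z_prim) // eq_sym oner_neq0.
(* The exponent kn - 1 becomes kn, which wraps around to 0. *)
have shiftM : z ^ weight (parts l) * M = M.
  rewrite -monomial_sym_homog // -[RHS](monomial_sym_perm (perm (@ordS_inj _))).
  rewrite /monomial_sym; apply: eq_bigr => mu _; apply: eq_bigr => i _.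
  rewrite /zeta_point permE /= expr_mod -?exprS //.
  by rewrite mulnC exprM (prim_expr_order z_prim) expr1n.
have wtE : weight (parts l) = (\sum_i (l i).+1)%N.
  by rewrite /weight -natz natr_sum; apply: eq_bigr => i _; rewrite ffunE natz.
apply/eqP; have /eqP := shiftM; rewrite -subr_eq0 -{2}[M]mul1r -mulrBl mulf_eq0.
case/orP => // /negPn/negP[]; rewrite subr_eq0 wtE -exprnP -(expr0 z).
by rewrite (eq_prim_root_expr z_prim); move: nz_wt; rewrite wtE !modz_nat.
Qed.

(** The linear form at [y] is the generating function of the powers of [y] with
   exponents 1, ..., n; in the product of such forms the terms with the same
   monomial in x are the rearrangements of a single sorted labelling. *)
Lemma prod_linear_forms (F : fieldType) (A : comAlgType F) (n k : nat)
    (y : 'I_(k * n) -> F) (x : 'I_n -> A) :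
  \prod_(i < k * n) \sum_(r < n) y i ^+ r.+1 *: x r =
    \sum_(l in Lambda n k) monomial_sym (parts l) y *: x_monomial x l.
Proof.
rewrite bigA_distr_bigA (partition_big (@sorted_rearr n _) (mem (Lambda n k))) /=;
  last by move=> f _; apply: sorted_rearr_Lambda.
apply: eq_bigr => l Ll; rewrite monomial_sym_parts scaler_suml.
apply: eq_big => [f | f]; first exact: sorted_rearr_eq.
rewrite sorted_rearr_eq // => /(x_monomial_perm x) <-.
by rewrite scaler_prod.
Qed.

Theorem theorem1p4 (R : realType) (n : nat) (hn : (0 < n)%N)
    (z : R[i]%C) (hz : n.-primitive_root z) (k : nat) (hk : (0 < k)%N) :
  let x : 'I_n -> {mpoly R[i]%C[n]} := fun r => 'X_r in
  circulant_det x ^+ k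
    = \sum_(l in Lambda n k)
        monomial_sym (parts l) (zeta_point n k z) *: x_monomial x l
  /\
  circulant_det x ^+ k
    = \sum_(l in Lambda_tilde n k)
        monomial_sym (parts l) (zeta_point n k z) *: x_monomial x l.
Proof.
move=> x.
have zC_prim : n.-primitive_root (z%:MP_[n]) by rewrite fmorph_primitive_root.
have powE : circulant_det x ^+ k = \sum_(l in Lambda n k)
    monomial_sym (parts l) (zeta_point n k z) *: x_monomial x l.
  rewrite (circulant_det_prod _ zC_prim).
  pose G m := \sum_(r < n) (z%:MP_[n]) ^+ (m * r.+1) * x r.
  rewrite -(prod_periodic k (G := G)) => [|m]; last first.
    apply: eq_bigr => r _; congr (_ * _).
    by rewrite mulnDl exprD exprM (prim_expr_order zC_prim) expr1n mul1r.
  rewrite -prod_linear_forms; apply: eq_bigr => m _; apply: eq_bigr => r _.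
  by rewrite -rmorphXn mul_mpolyC exprM.
split=> //; rewrite powE.
rewrite (bigID (fun l => (weight (parts l) == 0 %[mod n%:Z])%Z)) /=.
rewrite [X in _ + X]big1 ?addr0 => [|l /andP[_ nz_wt]]; last first.
  by rewrite monomial_sym_zeta0 ?scale0r.
by apply: eq_bigl => l; rewrite [RHS]inE.
Qed.
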